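(* Let $G=(V,E)$ be a graph, let $n\ge 2$, and let $\{x_1,y_1\},\ldots,\{x_n,y_n\}$ be different unordered pairs of distinct vertices of $G$. For each $i\in\{1,\ldots,n\}$, let $\mathcal{Q}_i$ be a set of paths in $G$ connecting $x_i$ and $y_i$, where $|\mathcal{Q}_i|\ge m$ for some fixed positive integer $m$. Let $k$ be a nonnegative integer and assume that for all distinct $i,j\in\{1,\ldots,n\}$, each path in $\mathcal{Q}_i$ shares an edge with at most $k$ paths in $\mathcal{Q}_j$. If $$\begin{cases} k<m, & \text{when } n=2,\\[1mm] e\cdot\dfrac{k}{m}\cdot(2n-4)\le 1, & \text{when } n\ge 3,\end{cases}$$ then there exist paths $P_i\in\mathcal{Q}_i$, for all $i\in\{1,\ldots,n\}$, such that $P_1,\ldots,P_n$ are pairwise edge-disjoint.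
   Context: Here $e$ in the inequality is the base of the natural logarithm. Paths are pairwise edge-disjoint if no two of them (with different indices) have a common edge. *)

(* Defs.v *)
From HB Require Import structures.
From mathcomp Require Import all_boot all_order all_algebra.
From mathcomp Require Import all_classical reals sequences exp.

Set Implicit Arguments.
Unset Strict Implicit.
Unset Printing Implicit Defensive.

Local Open Scope classical_set_scope.

(* A simple graph, finite or infinite, is a type of vertices with a symmetric,
   irreflexive adjacency relation; its edges are the pairs [set u; v] with u
   adjacent to v. *)
Definition simple_graph (V : eqType) (adj : rel V) : Prop :=
  symmetric adj /\ irreflexive adj.

(* A path (without repeated vertices) is listed as its vertices from x to y,
   both included.  For x != y, reading from x to y makes this list unique, so
   counting lists is the same as counting undirected paths between x and y. *)
Definition connecting_path (V : eqType) (adj : rel V) (x y : V) (s : seq V) :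
    Prop :=
  exists p : seq V,
    [/\ s = x :: p, path adj x p, uniq (x :: p) & last x p = y].

Definition path_edges (V : eqType) (s : seq V) : set (set V) :=
  [set [set uv.1; uv.2] | uv in [set` zip s (behead s)]].

Definition share_edge (V : eqType) (s t : seq V) : Prop :=
  path_edges s `&` path_edges t !=set0.

Definition edge_disjoint (V : eqType) (s t : seq V) : Prop :=
  path_edges s `&` path_edges t = set0.

(* Main.v *)
(* Choose m paths from each Q_i and pick one of them in each family uniformly
   and independently.  Let a(S) be the number of picks without conflict inside
   S.  At most (k/m) a(S \ j) picks have no conflict inside S \ j and a conflict
   between i and j, since the pick in Q_j is free there.  Hence
   a(S + i) >= a(S) - (k/m) \sum_(j in S) a(S \ j), and if 4k(n-2) <= m,
   induction on |S| < n gives a(S \ j) <= 2 a(S) for j in S (Rosenfeld's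
   counting argument in place of the local lemma).  Adding the last family
   leaves a positive count because 2k(n-1) < m when n >= 3; for n = 2 the
   factor 2 can be dropped and k < m is enough.  The bounds for n >= 3 follow
   from the hypothesis because e > 2. *)
Require Import Defs.
From HB Require Import structures.
From mathcomp Require Import all_boot all_order all_algebra.
From mathcomp Require Import all_classical reals sequences exp.
From mathcomp Require Import zify ring.

Set Implicit Arguments.
Unset Strict Implicit.
Unset Printing Implicit Defensive.

Import Order.TTheory GRing.Theory Num.Theory.

(** Read a = a(S \ i), b = a(S), u = |S \ i| and d as the sum of the a(S \ i \ j): the loss k d is
    at most 2kua, hence at most half of ta. *)
Lemma le_double_of_loss t u k a b d : 0 < t -> 4 * k * u <= t ->
  d <= u * (2 * a) -> t * a <= t * b + k * d -> a <= 2 * b.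
Proof.
move=> t0 kut /(leq_mul (leqnn k)) kd tab; rewrite -(leq_pmul2l t0).
move/(leq_mul (leqnn a)): kut => kut; lia.
Qed.

(** For the last family: b = 0 would give ta <= 2kua < ta. *)
Lemma gt0_of_loss t u k a b d : 0 < a -> 2 * k * u < t ->
  d <= u * (2 * a) -> t * a <= t * b + k * d -> 0 < b.
Proof.
case: b => // a0 kut /(leq_mul (leqnn k)) kd.
by rewrite -(ltn_pmul2r a0) in kut; lia.
Qed.

Section IndependentTransversal.
Variables (I T : finType) (c : rel (I * T)) (k : nat).
Hypothesis c_sym : symmetric c.
Hypothesis c_deg :
  forall i j, i != j -> forall a, #|[pred b | c (i, a) (j, b)]| <= k.

Implicit Types (S : {set I}) (f : {ffun I -> T}).

(** [f] also picks outside [S], where it is free, so counts for different [S] live in one space and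
    compare without normalisation. *)
Definition independent_on S f : bool :=
  [forall i in S, forall j in S, (i != j) ==> ~~ c (i, f i) (j, f j)].

Definition independent_count S : nat := #|[pred f | independent_on S f]|.

Lemma independent_onP S f :
  reflect {in S &, forall i j, i != j -> ~~ c (i, f i) (j, f j)}
          (independent_on S f).
Proof.
apply: (iffP forall_inP) => [h i j iS jS ij|h i iS].
  by have /forall_inP/(_ j jS)/implyP/(_ ij) := h i iS.
by apply/forall_inP => j jS; apply/implyP; apply: h.
Qed.

Lemma independent_onU1 S f i : i \notin S ->
  independent_on (i |: S) f =
  independent_on S f && [forall j in S, ~~ c (i, f i) (j, f j)].
Proof.
move=> iS; apply/independent_onP/andP => [h|[/independent_onP h /forall_inP hi]].
  split; first by apply/independent_onP => u v uS vS; apply: h; exact: setU1r.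
  apply/forall_inP => j jS; apply: h; rewrite ?finset.setU11 ?setU1r//.
  by apply: contraNneq iS => ->.
move=> u v /finset.setU1P[->|uS] /finset.setU1P[->|vS]; rewrite ?eqxx// => uv.
- exact: hi.
- by rewrite c_sym hi.
- exact: h.
Qed.

Definition ffun_upd f (j : I) (t : T) : {ffun I -> T} :=
  [ffun u => if u == j then t else f u].

(* If membership in X ignores coordinate j, then resampling that coordinate
   hits a neighbour of (i, f i) with probability at most k / #|T|. *)
Lemma card_resample (X : pred {ffun I -> T}) i j : i != j ->
  (forall f t, X (ffun_upd f j t) = X f) ->
  #|T| * #|[pred f | X f && c (i, f i) (j, f j)]| <= k * #|X|.
Proof.
(* [h] swaps the value at [j] with a spare value [t]. After reindexing, for each [f] in [X] the
   conflict constrains [t] alone, and at most [k] values meet it. *)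
move=> ij XE; pose h (p : {ffun I -> T} * T) := (ffun_upd p.1 j p.2, p.1 j).
have hK : involutive h.
  move=> [f t]; rewrite /h /= ffunE eqxx; congr pair.
  by apply/ffunP => u; rewrite !ffunE; case: eqP => [->|].
rewrite mulnC -cardX -sum1_card.
rewrite (reindex_inj (inv_inj hK)) /=.
rewrite (eq_bigl (fun p => X p.1 && c (i, p.1 i) (j, p.2))); last first.
  by move=> [f t]; rewrite !inE /= !XE !ffunE eqxx (negPf ij) andbT.
rewrite -(pair_big_dep X (fun f t => c (i, f i) (j, t)) (fun _ _ => 1)) /=.
rewrite mulnC -sum_nat_const; apply: leq_sum => f _.
by rewrite sum1_card; apply: c_deg.
Qed.

Lemma independent_count_extend S i : i \notin S ->
  #|T| * independent_count S <=
  #|T| * independent_count (i |: S) +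
  k * \sum_(j in S) independent_count (S :\ j).
Proof.
move=> iS.
(* Union bound: a pick lost when [i] is added conflicts with some [j] in [S]. Independence is
   weakened to [S :\ j], which ignores coordinate [j], as [card_resample] requires. *)
have le : independent_count S <= independent_count (i |: S) +
    \sum_(j in S) #|[pred f | independent_on (S :\ j) f && c (i, f i) (j, f j)]|.
  pose bad f := [exists j in S, c (i, f i) (j, f j)].
  rewrite {1}/independent_count -(cardID [pred f | bad f]) addnC leq_add//.
    apply: subset_leq_card; apply/fintype.subsetP => f; rewrite !inE.
    by rewrite independent_onU1// negb_exists_in andbC.
  rewrite -sum1_card; under [leqRHS]eq_bigr do rewrite -sum1_card.
  rewrite [leqRHS](exchange_big_dep predT)//= big_mkcond /=.
  apply: leq_sum => f _; case: ifP => //.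
  rewrite !inE => /andP[/independent_onP fS /exists_inP[j jS cij]].
  rewrite (bigD1 j) //= !inE jS cij andbT /=.
  apply/independent_onP => u v /finset.setD1P[_ uS] /finset.setD1P[_ vS]; exact: fS.
apply: leq_trans (leq_mul (leqnn #|T|) le) _.
rewrite mulnDr leq_add2l big_distrr big_distrr /=; apply: leq_sum => j jS.
apply: card_resample => [|f t]; first by apply: contraNneq iS => ->.
have E u : u \in S :\ j -> ffun_upd f j t u = f u.
  by rewrite !inE ffunE => /andP[/negPf->].
by apply/independent_onP/independent_onP => h u v uS vS uv;
   have := h u v uS vS uv; rewrite !E.
Qed.

Lemma independent_count_double S i : 4 * k * #|S|.-1 <= #|T| -> 0 < #|T| ->
  i \in S -> independent_count (S :\ i) <= 2 * independent_count S.
Proof.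
have [s] := ubnP #|S|; elim: s S i => // s IHs S i Ss STk T0 iS.
set S' := S :\ i.
have cS : #|S| = #|S'|.+1 by rewrite (cardsD1 i) iS.
have := independent_count_extend (negbT (finset.setD11 i S)).
rewrite finset.setD1K// -/S'.
have sumle : \sum_(j in S') independent_count (S' :\ j) <=
    #|S'| * (2 * independent_count S').
  rewrite -sum_nat_const; apply: leq_sum => j jS; apply: IHs => //; nia.
by apply: le_double_of_loss sumle => //; rewrite cS in STk.
Qed.

Lemma independent_transversal : 2 <= #|I| -> k < #|T| ->
  4 * k * (#|I| - 2) <= #|T| -> (3 <= #|I| -> 2 * k * (#|I| - 1) < #|T|) ->
  exists f, forall i j, i != j -> ~~ c (i, f i) (j, f j).
Proof.
move=> I2 kT I4 I3; have T0 : 0 < #|T| by apply: leq_ltn_trans kT.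
have [i _] : exists i : I, i \in predT by apply/card_gt0P; exact: ltnW.
(* One family is held back: doubling is used only up to |I| - 1 families, and the last addition
   needs only positivity. *)
pose S := [set: I]%SET :\ i.
have cS : #|S|.+1 = #|I| by rewrite -cardsT [RHS](cardsD1 i) finset.in_setT.
(* Doubling carries positivity up from the empty set, where every pick counts. *)
have pos S' : #|S'| <= #|S| -> 0 < independent_count S'.
  have [s] := ubnP #|S'|; elim: s S' => // s IHs S' S's S'S.
  have [->|[j jS']] := set_0Vmem S'.
    have [t _] : exists t : T, t \in predT by apply/card_gt0P.
    apply/card_gt0P; exists [ffun=> t].
    by apply/independent_onP => u; rewrite finset.in_set0.
  have cS' : #|S'| = #|S' :\ j|.+1 by rewrite (cardsD1 j) jS'.
  have : 4 * k * #|S'|.-1 <= #|T| by nia.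
  move=> /independent_count_double/(_ T0 jS').
  have /IHs : #|S' :\ j| < s by lia.
  by move=> /(_ ltac:(lia)); lia.
suff /card_gt0P[f /independent_onP fT] : 0 < independent_count [set: I]%SET.
  by exists f => u v; apply: fT; exact: finset.in_setT.
have := independent_count_extend (negbT (finset.setD11 i [set: I]%SET)).
rewrite finset.setD1K ?finset.in_setT// -/S.
have Spos := pos S (leqnn _).
have sumle : \sum_(j in S) independent_count (S :\ j) <=
    #|S| * (2 * independent_count S).
  rewrite -sum_nat_const; apply: leq_sum => j jS.
  by apply: independent_count_double => //; nia.
have [I3'|I2'] := leqP 3 #|I|.
  apply: gt0_of_loss Spos _ sumle.
  by have := I3 I3'; rewrite -cS subn1.
have /cards1P[j Sj] : #|S| == 1 by apply/eqP; lia.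
(* A singleton has no internal conflict, so the factor 2 disappears and k < |T| suffices. *)
have le1 : independent_count (S :\ j) <= independent_count S.
  apply/subset_leq_card/fintype.subsetP => f _.
  apply/independent_onP => u v; rewrite Sj !inE => /eqP-> /eqP->.
  by rewrite eqxx.
rewrite {2}Sj big_set1; move: le1 Spos.
move: (independent_count _) (independent_count _) (independent_count _) => a b d.
nia.
Qed.
End IndependentTransversal.

(** Each Q_i may be infinite; this selects m of its paths, so that the counting runs over finite
    types. *)
Lemma card_le_ord_inj (U : Type) (A : set U) (m : nat) : (`I_m #<= A)%card ->
  exists2 f : 'I_m -> U, injective f & forall a, A (f a).
Proof.
move=> /card_leP[g].
have mem (a : 'I_m) : (a : nat) \in `I_m by apply/mem_set => /=.
exists (fun a => set_val (g (SigSub (mem a)))) => [a b /val_inj ab|a].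
  have inT c : c \in [set: `I_m]%classic by rewrite in_setT.
  have [] := 'inj_g (inT _) (inT _) ab; exact: val_inj.
exact: set_valP.
Qed.

Lemma card_pred_le (U : Type) (T : finType) (f : T -> U) (P : pred T)
    (A : set U) (k : nat) :
  injective f -> (forall a, P a -> A (f a)) -> (A #<= `I_k)%card -> #|P| <= k.
Proof.
move=> f_inj PA /pcard_leP[g].
rewrite cardE -(size_iota 0 k) -(size_map (g \o f)).
apply: uniq_leq_size => [|_ /mapP[a aP ->]].
  rewrite map_inj_in_uniq ?enum_uniq// => a b; rewrite !mem_enum => aP bP /= ab.
  by apply/f_inj/('inj_g _ _ ab); apply/mem_set/PA.
rewrite mem_enum in aP; rewrite mem_iota /=.
by have /= := @funS _ _ _ _ g _ (PA _ aP).
Qed.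

Lemma expR_bound_nat (R : realType) (n m k : nat) : (0 < m)%N -> (3 <= n)%N ->
  (expR 1 * (k%:R / m%:R) * (2 * n%:R - 4) <= 1 :> R)%R ->
  k = 0 \/ 4 * k * (n - 2) < m.
Proof.
move=> m0 n3 h; have [->|k0] := posnP k; [by left | right].
(* This is exp x > 1 + x at x = 1; since k > 0, replacing e by 2 makes the inequality strict. *)
have e2 : (2 < expR 1 :> R)%R.
  by have := @expR_gt1Dx R 1%R (oner_neq0 _); rewrite -natr1.
have n0 : (0 < 2 * n%:R - 4 :> R)%R.
  by rewrite subr_gt0 -natrM ltr_nat; lia.
have m0R : (0 < m%:R :> R)%R by rewrite ltr0n.
have : (2 * (k%:R / m%:R) * (2 * n%:R - 4) < 1 :> R)%R.
  apply: lt_le_trans h; rewrite ltr_pM2r// ltr_pM2r// divr_gt0// ltr0n//.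
rewrite mulrA mulrAC ltr_pdivrMr// mul1r => h'.
rewrite -(ltr_nat R) !natrM natrB; last by lia.
by apply: le_lt_trans h'; rewrite le_eqVlt; apply/orP; left; apply/eqP; ring.
Qed.

Local Open Scope card_scope.
Local Open Scope classical_set_scope.
Local Open Scope ring_scope.

Theorem theorem4 (R : realType) (V : eqType) (adj : rel V)
    (G_graph : simple_graph adj)
    (n : nat) (n_ge2 : (2 <= n)%N)
    (x y : 'I_n -> V)
    (xy_neq : forall i, x i != y i)
    (xy_diff : forall i j, i != j -> [set x i; y i] <> [set x j; y j])
    (m : nat) (m_gt0 : (0 < m)%N)
    (Q : 'I_n -> set (seq V))
    (Q_path : forall i s, Q i s -> connecting_path adj (x i) (y i) s)
    (Q_card : forall i, `I_m #<= Q i)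
    (k : nat)
    (Q_share : forall i j, i != j -> forall s, Q i s ->
       [set t | Q j t /\ share_edge s t] #<= `I_k)
    (km_n2 : n = 2%N -> (k < m)%N)
    (km_n3 : (3 <= n)%N ->
       expR 1 * (k%:R / m%:R) * (2 * n%:R - 4) <= 1 :> R) :
  exists P : 'I_n -> seq V,
    (forall i, Q i (P i)) /\
    (forall i j, i != j -> edge_disjoint (P i) (P j)).
Proof.
have Q_enum i := card_le_ord_inj (Q_card i).
pose f i : 'I_m -> seq V := sval (cid2 (Q_enum i)).
have f_inj i : injective (f i) by rewrite /f; case: cid2.
have fQ i a : Q i (f i a) by rewrite /f; case: cid2.
pose c := [rel p q : 'I_n * 'I_m | `[<share_edge (f p.1 p.2) (f q.1 q.2)>]].
have c_sym : symmetric c.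
  by move=> p q; rewrite /= /share_edge setIC.
have c_deg i j : i != j -> forall a, (#|[pred b | c (i, a) (j, b)]| <= k)%N.
  move=> ij a; apply: card_pred_le (f_inj j) _ (Q_share i j ij _ (fQ i a)).
  by move=> b /asboolP ?; split; first exact: fQ.
have [|||| g gP] := independent_transversal c_sym c_deg; rewrite ?card_ord //.
- have [n3|n3] := leqP 3 n; last by apply: km_n2; lia.
  by have [->//|] := expR_bound_nat m_gt0 n3 (km_n3 n3); nia.
- have [n3|n3] := leqP 3 n; last by nia.
  by have [->//|] := expR_bound_nat m_gt0 n3 (km_n3 n3); nia.
(* For n >= 3, n - 1 <= 2(n - 2), so 2k(n - 1) <= 4k(n - 2) < m. *)
- move=> n3; have [->|] := expR_bound_nat m_gt0 n3 (km_n3 n3); nia.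
exists (fun i => f i (g i)); split=> // i j ij.
apply: contra_notP (elimN idP (gP i j ij)).
by move=> /eqP/set0P h; apply/asboolP.
Qed.
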